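(* Let $w\ge 1$, $s\ge w+4$, and let $L_1,\dots,L_w$ be pairwise orthogonal Latin squares of order $s$ on the cells $(i,j)$, $0\le i,j\le s-1$. Call two distinct cells first associates if they lie in different rows, different columns and carry different symbols in each $L_k$. Suppose one of the following holds: (iii) $s>(s-1-w-1)^2$, and for every cell $t$ the $(s-1-w)(s-1)$ first associates of $t$ can be divided into $s-1-w$ pairwise disjoint sets $A_1,\dots,A_{s-1-w}$ such that each $\{t\}\cup A_i$ is a common transversal of $L_1,\dots,L_w$; (v) for every cell $t$ there is chosen a division of its first associates into $s-1-w$ pairwise disjoint sets $A^t_1,\dots,A^t_{s-1-w}$ with each $\{t\}\cup A^t_i$ a common transversal, such that for any two distinct first associates $t_1,t_2$, writing $A^1_i=A^{t_1}_i$, $A^2_j=A^{t_2}_j$ and letting $t_2\in A^1_{i_1}$, $t_1\in A^2_{j_1}$: (a) $\{t_1\}\cup A^1_{i_1}=\{t_2\}\cup A^2_{j_1}$; (b) for every $i_2\neq i_1$ there is exactly one $j_2\neq j_1$ with $(\{t_1\}\cup A^1_{i_2})\cap(\{t_2\}\cup A^2_{j_2})=\emptyset$, and for each $j'\notin\{j_1,j_2\}$ the intersection $(\{t_1\}\cup A^1_{i_2})\cap(\{t_2\}\cup A^2_{j'})$ is a single cell that is a first associate of both $t_1,t_2$; (c) for every $j_3\neq j_1$ there is exactly one $i_3\neq i_1$ with $(\{t_2\}\cup A^2_{j_3})\cap(\{t_1\}\cup A^1_{i_3})=\emptyset$, and for each $i'\notin\{i_1,i_3\}$ the intersection $(\{t_2\}\cup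 A^2_{j_3})\cap(\{t_1\}\cup A^1_{i'})$ is a single cell that is a first associate of both $t_1,t_2$. Then there exist Latin squares $L_{w+1},\dots,L_{s-1}$ of order $s$ such that $L_1,\dots,L_{s-1}$ are pairwise orthogonal (the POL$(s,w)$ extends to a POL$(s,s-1)$).
   Context: Two Latin squares of order $s$ are orthogonal if superimposing them yields all $s^2$ ordered pairs of symbols; a POL$(s,w)$ is a set of $w$ pairwise orthogonal Latin squares of order $s$. A common transversal of $L_1,\dots,L_w$ is a set of $s$ cells with one cell in each row and each column carrying $s$ distinct symbols in each $L_k$ (equivalently, $s$ cells pairwise first associates). *)

(* Defs.v *)
From mathcomp Require Import all_boot all_algebra.

Set Implicit Arguments.
Unset Strict Implicit.
Unset Printing Implicit Defensive.

(* Cells are (row, column) pairs; the s symbols are taken to be 'I_s. *)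
Definition cell (s : nat) : finType := ('I_s * 'I_s)%type.

Definition latin (s : nat) (L : 'M['I_s]_s) : Prop :=
  (forall i a, exists! j, L i j = a) /\ (forall j a, exists! i, L i j = a).

Definition orthogonal (s : nat) (L M : 'M['I_s]_s) : Prop :=
  forall a b, exists i j, L i j = a /\ M i j = b.

Definition POL (s w : nat) (L : 'I_w -> 'M['I_s]_s) : Prop :=
  (forall k, latin (L k)) /\ (forall k l, k != l -> orthogonal (L k) (L l)).

Definition first_associate (s w : nat) (L : 'I_w -> 'M['I_s]_s)
    (t u : cell s) : bool :=
  [&& t.1 != u.1, t.2 != u.2 & [forall k, L k t.1 t.2 != L k u.1 u.2]].

Definition common_transversal (s w : nat) (L : 'I_w -> 'M['I_s]_s)
    (T : {set cell s}) : Prop :=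
  [/\ #|T| = s,
      forall i, #|[set c in T | c.1 == i]| = 1,
      forall j, #|[set c in T | c.2 == j]| = 1
    & forall k, #|[set L k c.1 c.2 | c in T]| = s].

Definition transversal_division (s w m : nat) (L : 'I_w -> 'M['I_s]_s)
    (t : cell s) (A : 'I_m -> {set cell s}) : Prop :=
  [/\ forall i j, i != j -> [disjoint A i & A j],
      \bigcup_(i < m) A i = [set u | first_associate L t u]
    & forall i, common_transversal L (t |: A i)].

(* A1 and A2 divide the first associates of t1 and t2, with t2 in A1 i1 and
   t1 in A2 j1.  The condition is not symmetric in (t1, A1, i1) and (t2, A2, j1). *)
Definition meeting_condition (s w m : nat) (L : 'I_w -> 'M['I_s]_s)
    (t1 t2 : cell s) (A1 A2 : 'I_m -> {set cell s}) (i1 j1 : 'I_m) : Prop :=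
  forall i2, i2 != i1 ->
  exists j2,
    unique (fun j => j != j1 /\ (t1 |: A1 i2) :&: (t2 |: A2 j) = set0) j2 /\
    (forall j', j' != j1 -> j' != j2 ->
     exists u, [/\ (t1 |: A1 i2) :&: (t2 |: A2 j') = [set u],
                   first_associate L t1 u & first_associate L t2 u]).

Definition small_deficiency_condition (s w : nat) (L : 'I_w -> 'M['I_s]_s) : Prop :=
  (s - 1 - w - 1) ^ 2 < s /\
  (forall t : cell s, exists A : 'I_(s - 1 - w) -> {set cell s},
     transversal_division L t A).

Definition compatible_divisions_condition (s w : nat) (L : 'I_w -> 'M['I_s]_s) : Prop :=
  exists A : cell s -> 'I_(s - 1 - w) -> {set cell s},
    (forall t, transversal_division L t (A t)) /\
    (forall t1 t2, first_associate L t1 t2 ->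
     forall i1 j1, t2 \in A t1 i1 -> t1 \in A t2 j1 ->
       [/\ t1 |: A t1 i1 = t2 |: A t2 j1,
           meeting_condition L t1 t2 (A t1) (A t2) i1 j1
         & meeting_condition L t2 t1 (A t2) (A t1) j1 i1]).

(* Main.v *)
(* Call the sets [t |: A t i] lines.  Under either hypothesis a line is one of
   the chosen lines through each of its cells: this is clause (a) of the second
   hypothesis, and follows from the first one because a stray transversal
   through [t] would meet every line through [t] in few cells.  A cell [x] off a
   line [T] has exactly [s - w - 2] neighbours in [T], joined to [x] by different
   lines, so exactly one of the [s - w - 1] lines through [x] misses [T].  Hence
   disjointness is an equivalence relation with [s - 1 - w] parallel classes, and
   each class is the set of symbol classes of a new Latin square. *)

Require Import Defs.
From mathcomp Require Import all_boot all_algebra.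
From mathcomp Require Import zify.

Set Implicit Arguments.
Unset Strict Implicit.
Unset Printing Implicit Defensive.

(** * Coordinates of cells and common transversals *)

(** Rows, columns and symbols are put on the same footing, as the [w + 2] classes of a net; the
    index type is finite of that cardinality, which allows counting over it. *)
Definition coordinate (s w : nat) (L : 'I_w -> 'M['I_s]_s)
    (c : option (option 'I_w)) (x : cell s) : 'I_s :=
  match c with
  | None => x.1
  | Some None => x.2
  | Some (Some k) => L k x.1 x.2
  end.

Lemma first_associateP (s w : nat) (L : 'I_w -> 'M['I_s]_s) (t u : cell s) :
  reflect (forall c, coordinate L c t != coordinate L c u) (first_associate L t u).
Proof.
apply: (iffP and3P) => [[rtu ctu /forallP stu] [[k|]|] | tu]; [exact: stu | by [] | by [] |].
by split; [apply: tu None | apply: tu (Some None) | apply/forallP => k; apply: tu (Some (Some k))].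
Qed.

Lemma first_associateC (s w : nat) (L : 'I_w -> 'M['I_s]_s) (t u : cell s) :
  first_associate L t u = first_associate L u t.
Proof.
by apply/first_associateP/first_associateP => tu c; rewrite eq_sym.
Qed.

Lemma first_associate_irr (s w : nat) (L : 'I_w -> 'M['I_s]_s) (t : cell s) :
  first_associate L t t = false.
Proof. by rewrite /first_associate eqxx. Qed.

(** Superposition maps the [s ^ 2] cells onto the [s ^ 2] pairs of symbols, and a surjection between
    finite sets of equal size is injective. *)
Lemma orthogonal_inj (s : nat) (L M : 'M['I_s]_s) (x y : cell s) :
  Defs.orthogonal L M -> L x.1 x.2 = L y.1 y.2 -> M x.1 x.2 = M y.1 y.2 -> x = y.
Proof.
move=> LM Lxy Mxy; pose f (z : cell s) : cell s := (L z.1 z.2, M z.1 z.2).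
have surj (p : cell s) : exists z, f z = p.
  by case: p => a b; have [i [j [<- <-]]] := LM a b; exists (i, j).
have [g gK] := fin_all_exists surj.
by apply: (can_inj (canF_sym gK)); rewrite /f Lxy Mxy.
Qed.

(** This is the net axiom: the Latin property handles a row or column against a symbol,
    orthogonality handles two symbols. *)
Lemma coordinate_eq2 (s w : nat) (L : 'I_w -> 'M['I_s]_s) (c c' : option (option 'I_w))
    (x y : cell s) :
  POL L -> c != c' -> coordinate L c x = coordinate L c y ->
  coordinate L c' x = coordinate L c' y -> x = y.
Proof.
case=> latL orthL.
have row k : x.1 = y.1 -> L k x.1 x.2 = L k y.1 y.2 -> x = y.
  case: x y => [i j] [i' j'] /= <- e; have [z [_ uz]] := (latL k).1 i (L k i j).
  by rewrite -(uz j erefl) -(uz j' (esym e)).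
have col k : x.2 = y.2 -> L k x.1 x.2 = L k y.1 y.2 -> x = y.
  case: x y {row} => [i j] [i' j'] /= <- e; have [z [_ uz]] := (latL k).2 j (L k i j).
  by rewrite -(uz i erefl) -(uz i' (esym e)).
case: c c' => [[k|]|] [[l|]|] //= neq e1 e2.
- by apply: (@orthogonal_inj _ (L k) (L l)) => //; apply: orthL; apply: contraNneq neq => ->.
- exact: (col k).
- exact: (row k).
- exact: (col l).
- by case: x y e1 e2 {row col} => [? ?] [? ?] /= -> ->.
- exact: (row l).
- by case: x y e1 e2 {row col} => [? ?] [? ?] /= -> ->.
Qed.

Lemma transversal_inj (s w : nat) (L : 'I_w -> 'M['I_s]_s) (T : {set cell s})
    (c : option (option 'I_w)) :
  common_transversal L T -> {in T &, injective (coordinate L c)}.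
Proof.
case=> cardT rowT colT symT; case: c => [[k|]|] /=.
- by apply/imset_injP; rewrite symT cardT.
- move=> x y xT yT e; have /eqP/cards1P[z Ez] := colT x.2.
  have : x \in [set z] by rewrite -Ez inE xT eqxx.
  have : y \in [set z] by rewrite -Ez inE yT e eqxx.
  by rewrite !inE => /eqP-> /eqP->.
- move=> x y xT yT e; have /eqP/cards1P[z Ez] := rowT x.1.
  have : x \in [set z] by rewrite -Ez inE xT eqxx.
  have : y \in [set z] by rewrite -Ez inE yT e eqxx.
  by rewrite !inE => /eqP-> /eqP->.
Qed.

Lemma transversal_surj (s w : nat) (L : 'I_w -> 'M['I_s]_s) (T : {set cell s})
    (c : option (option 'I_w)) (a : 'I_s) :
  common_transversal L T -> exists2 x, x \in T & coordinate L c x = a.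
Proof.
move=> trT; have : a \in coordinate L c @: T.
  suff -> : coordinate L c @: T = setT by rewrite inE.
  apply/eqP; rewrite eqEcard subsetT cardsT card_ord.
  rewrite (card_in_imset (transversal_inj (c := c) trT)).
  by case: trT => -> _ _ _ /=.
by case/imsetP => x xT ->; exists x.
Qed.

Lemma transversal_first_associate (s w : nat) (L : 'I_w -> 'M['I_s]_s)
    (T : {set cell s}) (x y : cell s) :
  common_transversal L T -> x \in T -> y \in T -> x != y -> first_associate L x y.
Proof.
move=> trT xT yT neq; apply/first_associateP => c.
by apply: contraNneq neq => /(transversal_inj trT)->.
Qed.

(* For each of the [w + 2] coordinates, exactly one cell of [T] agrees with [x],
   and these cells are distinct since two coordinates determine a cell. *)
Lemma card_first_associates_in_transversal (s w : nat) (L : 'I_w -> 'M['I_s]_s)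
    (T : {set cell s}) (x : cell s) :
  POL L -> common_transversal L T -> x \notin T ->
  #|[set y in T | first_associate L x y]| = s - (w + 2).
Proof.
move=> hL trT xT.
have [f fT fx] := fin_all_exists2 (fun c => transversal_surj c (coordinate L c x) trT).
have f_inj : injective f.
  move=> c c' e; apply/eqP; apply: contraNT xT => neq.
  suff -> : x = f c by [].
  by apply: (coordinate_eq2 hL neq); rewrite ?fx // e fx.
have Ef : T :\: [set y in T | first_associate L x y] = f @: setT.
  apply/setP => y; rewrite !inE; apply/andP/imsetP => [[+ yT]|[c _ ->]].
    rewrite yT /= => /first_associateP nfa.
    have /existsP[c /eqP e] : [exists c, coordinate L c x == coordinate L c y].
      apply/existsPn => all_neq; exact: nfa.
    by exists c => //; apply: (transversal_inj (c := c) trT yT (fT c)); rewrite fx -e.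
  split=> //; rewrite fT; apply/first_associateP => /(_ c); by rewrite fx eqxx.
have := cardsID [set y in T | first_associate L x y] T.
rewrite Ef card_imset // cardsT !card_option card_ord.
have /setIidPr-> : [set y in T | first_associate L x y] \subset T.
  by apply/subsetP => y; rewrite inE => /andP[].
by case: trT => -> _ _ _; lia.
Qed.

(** * From parallel classes to orthogonal Latin squares *)

(** As in an affine plane, a line counts as parallel to itself, so that the relation can be an
    equivalence. *)
Definition parallel (s : nat) (l m : {set cell s}) : bool :=
  (l == m) || [disjoint l & m].

Lemma parallel_sym (s : nat) (l m : {set cell s}) : parallel l m = parallel m l.
Proof. by rewrite /parallel eq_sym disjoint_sym. Qed.

(* In the square of the parallel class of [l0 i], the symbol of a cell [x] is the
   column where the line of that class through [x] meets the row of [t0]. *)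
Lemma squares_of_parallel_classes (s w m : nat) (L : 'I_w -> 'M['I_s]_s)
    (lines : {set {set cell s}}) (t0 : cell s) (l0 : 'I_m -> {set cell s}) :
  POL L -> {in lines, forall T, common_transversal L T} ->
  (forall T x, T \in lines ->
     exists! l, [/\ l \in lines, x \in l & parallel l T]) ->
  injective l0 -> (forall i, l0 i \in lines) -> (forall i, t0 \in l0 i) ->
  exists M : 'I_(w + m) -> 'M['I_s]_s,
    (forall k, M (lshift m k) = L k) /\ POL M.
Proof.
move=> [latL orthL] trL playfair l0_inj l0L t0l0.
(* If [a] and [c] share a cell, both are the unique parallel to [b] through it, hence equal. *)
have par_trans a b c : a \in lines -> b \in lines -> c \in lines ->
    parallel a b -> parallel b c -> parallel a c.
  move=> aL bL cL ab bc; rewrite /parallel orbC -implyNb; apply/implyP.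
  case/pred0Pn => x /andP[xa xc]; have [l [_ ul]] := playfair b x bL.
  by rewrite -(ul a) // -(ul c) // parallel_sym.
(* [P (i, x)] is the line through [x] in the class of [l0 i]. *)
have [P PP] := fin_all_exists (fun p => playfair (l0 p.1) p.2 (l0L p.1)).
have PL i x : P (i, x) \in lines by case: (PP (i, x)) => -[].
have Px i x : x \in P (i, x) by case: (PP (i, x)) => -[].
have Ppar i x : parallel (P (i, x)) (l0 i) by case: (PP (i, x)) => -[].
have Pu i x l : l \in lines -> x \in l -> parallel l (l0 i) -> P (i, x) = l.
  by case: (PP (i, x)) => _ /(_ l) /= u ? ? ?; apply: u.
have PE i x y : y \in P (i, x) -> P (i, y) = P (i, x).
  by move=> yP; apply: Pu.
have Psym i x y : (y \in P (i, x)) = (x \in P (i, y)).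
  by apply/idP/idP => /PE ->.
(* Otherwise transitivity would make [l0 i] and [l0 i'] parallel, yet these are distinct lines
   sharing [t0]. *)
have Pmeet i i' x y : i != i' -> exists2 z, z \in P (i, x) & z \in P (i', y).
  move=> neq; case: (boolP [disjoint P (i, x) & P (i', y)]); last first.
    by case/pred0Pn => z /andP[? ?]; exists z.
  move=> dis; case/negP: neq.
  have p1 : parallel (P (i, x)) (l0 i').
    by apply: par_trans (PL i' y) _ _ (Ppar i' y) => //; apply/orP; right.
  have : parallel (l0 i) (l0 i').
    by apply: par_trans (PL i x) _ _ p1 => //; rewrite parallel_sym.
  case/orP => [/eqP/l0_inj-> //|/pred0P/(_ t0)/=].
  by rewrite !t0l0.
have [g gP] : exists g : 'I_m * cell s -> 'I_s,
    forall p, (t0.1, g p) \in P p.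
  apply: (@fin_all_exists _ _ (fun p j => (t0.1, j) \in P p)) => -[i x].
  have [[r c] yP /= <-] := transversal_surj None t0.1 (trL _ (PL i x)).
  by exists c.
pose N i : 'M['I_s]_s := (\matrix_(r, c) g (i, (r, c)))%R.
(* The cells of symbol [a] in [N i] form one line, which meets the row of [t0] only in column [a].
   The Latin property and both kinds of orthogonality are read off from this. *)
have NE i x a : (N i x.1 x.2 = a) <-> (x \in P (i, (t0.1, a))).
  rewrite mxE -surjective_pairing; split=> [<-|xP]; first by rewrite Psym.
  have aP := gP (i, x); rewrite (PE _ _ _ xP) in aP.
  have := transversal_inj (c := None) (trL _ (PL i (t0.1, a))) aP (Px _ _) erefl.
  by case.
have latN i : latin (N i).
  split=> [r|c] a; have trP := trL _ (PL i (t0.1, a)).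
    have [[r' c] yP /= rr'] := transversal_surj None r trP; subst r'.
    exists c; split=> [|c' /(NE i (r, c')) y'P]; first exact/(NE i (r, c)).
    by have [] := transversal_inj (c := None) trP yP y'P erefl.
  have [[r c'] yP /= cc'] := transversal_surj (Some None) c trP; subst c'.
  exists r; split=> [|r' /(NE i (r', c)) y'P]; first exact/(NE i (r, c)).
  by have [] := transversal_inj (c := Some None) trP yP y'P erefl.
(* The line of symbol [a] is a transversal of [L k], so it carries the symbol [b]. *)
have orthNL i k a b : exists r c, N i r c = a /\ L k r c = b.
  have [[r c] yP /= eb] := transversal_surj (Some (Some k)) b (trL _ (PL i (t0.1, a))).
  by exists r, c; split=> //; apply/(NE i (r, c)).
exists (fun k => match split k with inl k => L k | inr i => N i end); split.
  by move=> k; rewrite (unsplitK (inl k)).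
split=> [k|k l]; first by case: split.
rewrite -(inj_eq (can_inj splitK)) => + a b.
case: (split k) (split l) => [k'|i] [l'|j] => [kl|_|_|ij].
- by apply: orthL; apply: contraNneq kl => ->.
- by have [r [c []]] := orthNL j k' b a; exists r, c.
- exact: orthNL.
- have [|[r c] zi zj] := Pmeet i j (t0.1, a) (t0.1, b); first by apply: contraNneq ij => ->.
  by exists r, c; split; [apply/(NE i (r, c)) | apply/(NE j (r, c))].
Qed.

(** * Divisions into transversals and the lines they define *)

Lemma division_mem (s w m : nat) (L : 'I_w -> 'M['I_s]_s) (t u : cell s)
    (A : 'I_m -> {set cell s}) :
  transversal_division L t A -> reflect (exists i, u \in A i) (first_associate L t u).
Proof.
case=> _ cov _; have -> : first_associate L t u = (u \in \bigcup_(i < m) A i).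
  by rewrite cov inE.
by apply: (iffP bigcupP) => [[i _ ui]|[i ui]]; exists i.
Qed.

Lemma division_uniq (s w m : nat) (L : 'I_w -> 'M['I_s]_s) (t u : cell s)
    (A : 'I_m -> {set cell s}) (i j : 'I_m) :
  transversal_division L t A -> u \in A i -> u \in A j -> i = j.
Proof.
case=> dis _ _ ui uj; apply/eqP; apply: contraTT ui => /dis/disjointFl -> //.
Qed.

(** Since [s > 1], each [A i] contains a cell; being a first associate of [t], it differs from [t],
    and by disjointness it lies in no other part. *)
Lemma division_line_inj (s w m : nat) (L : 'I_w -> 'M['I_s]_s) (t : cell s)
    (A : 'I_m -> {set cell s}) :
  1 < s -> transversal_division L t A -> injective (fun i => t |: A i).
Proof.
move=> s_gt1 divA i j /= e; have [_ _ /(_ i)[cardi _ _ _]] := divA.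
have : 0 < #|A i| by have := cardsU1 t (A i); rewrite cardi; case: (_ \notin _); lia.
case/card_gt0P => u ui; have : u \in t |: A j by rewrite -e !inE ui orbT.
rewrite !inE => /predU1P[ut|]; last exact: division_uniq divA ui.
have : first_associate L t u by apply/(division_mem u divA); exists i.
by rewrite ut first_associate_irr.
Qed.

Definition division_lines (s m : nat) (A : cell s -> 'I_m -> {set cell s}) :
    {set {set cell s}} :=
  [set p.1 |: A p.1 p.2 | p : cell s * 'I_m].

(** Both alternatives of the theorem are reduced to this property: a line chosen at one cell is
    chosen at all of its cells. *)
Definition coherent_divisions (s m : nat) (A : cell s -> 'I_m -> {set cell s}) : Prop :=
  forall t u i, u \in A t i -> exists j, u |: A u j = t |: A t i.

Lemma division_lineP (s m : nat) (A : cell s -> 'I_m -> {set cell s})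
    (l : {set cell s}) (x : cell s) :
  coherent_divisions A -> l \in division_lines A -> x \in l ->
  exists j, l = x |: A x j.
Proof.
move=> cohA /imsetP[[t i] _ ->] /=; rewrite !inE => /predU1P[->|]; first by exists i.
by case/cohA => j <-; exists j.
Qed.

Lemma division_playfair (s w : nat) (L : 'I_w -> 'M['I_s]_s)
    (A : cell s -> 'I_(s - 1 - w) -> {set cell s}) (T : {set cell s}) (x : cell s) :
  w + 2 <= s -> POL L -> (forall t, transversal_division L t (A t)) ->
  coherent_divisions A -> T \in division_lines A ->
  exists! l, [/\ l \in division_lines A, x \in l & parallel l T].
Proof.
move=> hs hL divA cohA TL.
have trT : common_transversal L T.
  by case/imsetP: TL => -[t i] _ ->; case: (divA t).
have [xT|xT] := boolP (x \in T).
  exists T; split=> [|l [_ xl]]; first by rewrite /parallel eqxx.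
  by case/orP => [/eqP-> //|/disjointFr/(_ xl)]; rewrite xT.
set N := [set y in T | first_associate L x y].
have fa_mem y : first_associate L x y -> exists j, y \in A x j.
  by move/(division_mem y (divA x)).
have mem_fa y j : y \in A x j -> first_associate L x y.
  by move=> yj; apply/(division_mem y (divA x)); exists j.
(* [J] indexes the lines through [x] that meet [T]. *)
pose J := [set j | [exists y in T, y \in A x j]].
have JP j : reflect (exists2 y, y \in T & y \in A x j) (j \in J).
  by rewrite inE; apply: (iffP exists_inP).
have [g gP] : exists g : cell s -> 'I_(s - 1 - w),
    forall y, first_associate L x y -> y \in A x (g y).
  apply: (@fin_all_exists _ _ (fun y j => first_associate L x y -> y \in A x j)) => y.
  have [/fa_mem[j yj]|_] := boolP (first_associate L x y); first by exists j.
  (* A default index, for cells that are not first associates of [x]. *)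
  have m_gt0 : 0 < s - 1 - w by lia.
  by exists (Ordinal m_gt0).
(* If [y] and [z] in [T] lay on one line through [x], that line and [T] would both belong to the
   division at [y] and contain [z]; they would coincide, putting [x] in [T]. *)
have g_inj : {in N &, injective g}.
  move=> y z; rewrite !inE => /andP[yT xy] /andP[zT xz] e.
  apply/eqP; apply: contraNT xT => neq.
  have [j1 E1] := division_lineP cohA TL yT.
  have [j2 E2] := cohA _ _ _ (gP y xy).
  have zj1 : z \in A y j1 by move: zT; rewrite E1 !inE eq_sym (negPf neq).
  have zj2 : z \in A y j2.
    have : z \in y |: A y j2 by rewrite E2 e !inE gP // orbT.
    by rewrite !inE eq_sym (negPf neq).
  by rewrite E1 (division_uniq (divA y) zj1 zj2) E2 setU11.
have EJ : J = g @: N.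
  apply/setP => j; apply/JP/imsetP => [[y yT yj]|[y + ->]].
    have xy := mem_fa _ _ yj; exists y; first by rewrite inE yT.
    exact: division_uniq (divA x) yj (gP y xy).
  by rewrite inE => /andP[yT xy]; exists y => //; apply: gP.
(* The count is [(s - 1 - w) - (s - (w + 2)) = 1]. *)
have /eqP/cards1P[j0 Ej0] : #|~: J| = 1.
  have := cardsC J; rewrite card_ord {1}EJ (card_in_imset g_inj).
  by rewrite /N (card_first_associates_in_transversal hL trT xT); lia.
have disP j : parallel (x |: A x j) T = (j == j0).
  rewrite -in_set1 -Ej0 inE /parallel orbC; apply/orP/idP => [[dis|/eqP E]|jJ].
  - apply/JP => -[y yT yj]; have := disjointFl dis yT.
    by rewrite !inE yj orbT.
  - by move: xT; rewrite -E setU11.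
  left; rewrite disjoint_sym; apply/pred0P => y /=; apply/negP => /andP[yT].
  rewrite !inE => /predU1P[yx|yj]; first by move: xT; rewrite -yx yT.
  by case/JP: jJ; exists y.
exists (x |: A x j0); split=> [|l [lL xl]].
  by rewrite disP eqxx setU11; split=> //; apply/imsetP; exists (x, j0).
have [j ->] := division_lineP cohA lL xl.
by rewrite disP => /eqP->.
Qed.

(* A transversal through [u] that is not one of the [m] lines of the division at
   [u] would meet each of them in at most [m - 2] cells besides [u], so that
   [s - 1 <= m (m - 2)]. *)
Lemma transversal_in_division (s w : nat) (L : 'I_w -> 'M['I_s]_s) (T : {set cell s})
    (u : cell s) (A : 'I_(s - 1 - w) -> {set cell s}) :
  w + 3 <= s -> (s - 1 - w - 1) ^ 2 < s -> POL L -> transversal_division L u A ->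
  common_transversal L T -> u \in T -> exists j, u |: A j = T.
Proof.
move=> hs small hL divA trT uT; apply/'exists_eqP; apply: contraLR small => /existsPn nT.
(* A cell [x] of the line outside [T] has [s - (w + 2)] first associates in [T]; they include [u]
   and all of [A j :&: T]. *)
have bound j : #|A j :&: T| <= s - w - 3.
  have [_ _ /(_ j) trj] := divA.
  have [cardT _ _ _] := trT; have [cardj _ _ _] := trj.
  have /subsetPn[x xj xT] : ~~ (u |: A j \subset T).
    by apply: contra (nT j) => sub; rewrite eqEcard sub cardT cardj /=.
  have := card_first_associates_in_transversal hL trT xT.
  have uj : u \notin A j.
    apply/negP => uj; have /negP := first_associate_irr L u; apply.
    by apply/(division_mem u divA); exists j.
  have sub : u |: (A j :&: T) \subset [set y in T | first_associate L x y].
    apply/subsetP => y; rewrite !inE => yjT.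
    have yT : y \in T by case/predU1P: yjT => [->|/andP[]].
    rewrite yT; apply: (transversal_first_associate trj xj).
      by rewrite !inE; case/predU1P: yjT => [->|/andP[->]]; rewrite ?eqxx ?orbT.
    by apply: contraNneq xT => ->.
  have := subset_leq_card sub; rewrite cardsU1 inE (negPf uj) /=; lia.
have ET : T :\ u = \bigcup_(j < s - 1 - w) (A j :&: T).
  apply/setP => y; rewrite !inE; apply/andP/bigcupP => [[yu yT]|[j _]].
    have : first_associate L u y by apply: (transversal_first_associate trT) => //; rewrite eq_sym.
    by case/(division_mem y divA) => j yj; exists j; rewrite // inE yj.
  rewrite inE => /andP[yj yT]; split=> //; apply/eqP => yu.
  have /negP := first_associate_irr L u; apply.
  by apply/(division_mem u divA); exists j; rewrite -yu.
have le : #|T :\ u| <= (s - 1 - w) * (s - w - 3).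
  rewrite ET -[X in X * _]card_ord -sum_nat_const.
  apply: (big_ind2 (fun (X : {set cell s}) n => #|X| <= n)) => // [|X n Y p Xn Yp].
    by rewrite cards0.
  by apply: leq_trans (leq_add Xn Yp); rewrite cardsU leq_subr.
have := cardsD1 u T; rewrite uT; case: trT => -> _ _ _.
(* With [k = s - (w + 3)], the bound [s - 1 <= (k + 2) * k] gives [s <= (k + 1) ^ 2], where
   [k + 1 = s - 1 - w - 1]. *)
rewrite -leqNgt; move: #|_| le => c; have -> : s = w + 3 + (s - (w + 3)) by lia.
move: (s - (w + 3)) => k.
have -> : w + 3 + k - 1 - w - 1 = k.+1 by lia.
have -> : w + 3 + k - 1 - w = k.+2 by lia.
have -> : w + 3 + k - w - 3 = k by lia.
by rewrite -mulnn; nia.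
Qed.

Theorem theorem3p12 (s w : nat) (L : 'I_w -> 'M['I_s]_s)
  (hw : 1 <= w) (hs : w + 4 <= s) (hL : POL L)
  (hcond : small_deficiency_condition L \/ compatible_divisions_condition L) :
  exists M : 'I_(s - 1) -> 'M['I_s]_s,
    (forall (k : 'I_w) (l : 'I_(s - 1)), k = l :> nat -> M l = L k) /\ POL M.
Proof.
have [A [divA cohA]] : exists A : cell s -> 'I_(s - 1 - w) -> {set cell s},
    (forall t, transversal_division L t (A t)) /\ coherent_divisions A.
  case: hcond => [[small /fin_all_exists[A divA]]|[A [divA compA]]]; exists A; split=> //.
    move=> t u i ui; apply: (transversal_in_division _ small hL (divA u)); first by lia.
      by case: (divA t).
    by rewrite !inE ui orbT.
  move=> t u i ui; have tu : first_associate L t u.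
    by apply/(division_mem u (divA t)); exists i.
  have := tu; rewrite first_associateC => /(division_mem t (divA u))[j tj].
  (* Clause (a) is exactly coherence. *)
  by have [-> _ _] := compA t u tu i j ui tj; exists j.
have s_gt0 : 0 < s by lia.
(* Any cell can serve as base point; the [s - 1 - w] lines through it represent the parallel
   classes. *)
pose t0 : cell s := (Ordinal s_gt0, Ordinal s_gt0).
have [|T x||||M [ML polM]] := @squares_of_parallel_classes s w (s - 1 - w) L
    (division_lines A) t0 (fun i => t0 |: A t0 i) hL.
- by move=> T /imsetP[[t i] _ ->]; case: (divA t).
- by move=> TL; apply: (division_playfair x _ hL divA cohA TL); lia.
- by apply: division_line_inj (divA t0); lia.
- by move=> i; apply/imsetP; exists (t0, i).
- by move=> i; rewrite setU11.
(* The two index types agree only up to this equation; the cast preserves values, so the first [w]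
   squares stay in place. *)
have e : s - 1 = w + (s - 1 - w) by lia.
exists (fun l => M (cast_ord e l)); split=> [k l kl|].
  by rewrite -(ML k); congr M; apply: val_inj.
case: polM => latM orthM; split=> [k|k l kl]; first exact: latM.
by apply: orthM; rewrite (inj_eq (@cast_ord_inj _ _ e)).
Qed.
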